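(* For any Tychonoff space $X$, the following are equivalent. (1) $C_{rc}(X)$ is metrizable. (2) $C_{rc}(X)$ is first countable. (3) $C_{rc}(X)$ is of countable type. (4) $C_{rc}(X)$ is of pointwise countable type. (5) $C_{rc}(X)$ has a dense subspace of pointwise countable type. (6) $C_{rc}(X)$ is an $M$-space. (7) $C_{rc}(X)$ is a $q$-space. (8) $X$ is hemi-$C$-compact; that is, there exists a sequence $\{A_n\}$ of $C$-compact subsets of $X$ such that for any $C$-compact subset $A$ of $X$, $A\subseteq A_n$ holds for some $n$.
   Context: $C(X)$ is the set of all continuous real-valued functions on $X$. A subset $A\subseteq X$ is a $C$-compact subset of $X$ if $f(A)$ is compact in $\mathbb{R}$ for every $f\in C(X)$. $C_{rc}(X)$ is $C(X)$ with the $C$-compact-open topology, whose subbase consists of all sets $[A,V]=\{f\in C(X): f(A)\subseteq V\}$ with $A$ a non-empty $C$-compact subset of $X$ and $V\subseteq\mathbb{R}$ open. A subset $K$ of a space $Y$ has countable character in $Y$ if there is a countable family of open sets containing $K$ such that every open set containing $K$ contains a member of the family. A space is of countable type (respectively, of pointwise countable type) if each compact set (respectively, each point) is contained in a compact set having countable character. A space $Y$ is a $q$-space if for each $y\in Y$ there is a sequence $\{U_n:n\in\mathbb{N}\}$ of neighborhoods of $y$ such that if $y_n\in U_n$ for each $n$, then $\{y_n:n\in\mathbb{N}\}$ has a cluster point. An $M$-space is a space that can be mapped onto a metric space by a quasi-perfect map, i.e. a continuous closed map in which inverse images of points are countably compact. *)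

(* Defs.v *)
From HB Require Import structures.
From mathcomp Require Import all_boot all_order all_algebra.
From mathcomp Require Import all_classical all_reals all_analysis.

Set Implicit Arguments.
Unset Strict Implicit.
Unset Printing Implicit Defensive.

Import Order.TTheory GRing.Theory Num.Theory.
Import numFieldNormedType.Exports.

Local Open Scope classical_set_scope.
Local Open Scope ring_scope.

Definition tychonoff_space (X : topologicalType) : Prop :=
  completely_regular_space X /\ hausdorff_space X.

Definition C_compact (R : realType) (X : topologicalType) (A : set X) : Prop :=
  forall f : continuousType X R, compact (f @` A).

(* An alias, so that the topology below does not compete with the other
   topologies that the library puts on [continuousType X R]. *)
Definition C_rc (R : realType) (X : topologicalType) : Type :=
  continuousType X R.

Section C_compact_open_topology.
Variables (R : realType) (X : topologicalType).

HB.instance Definition _ := Choice.copy (C_rc R X) (continuousType X R).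

(* Indexed by pairs (A, V); [A, V] is the set of f with f(A) included in V. *)
HB.instance Definition _ := @isSubBaseTopological.Build (C_rc R X)
  (set X * set R)%type
  [set AV | [/\ AV.1 !=set0, C_compact R AV.1 & open AV.2]]
  (fun AV => [set f : continuousType X R | f @` AV.1 `<=` AV.2]).

End C_compact_open_topology.

Definition metrizable (R : realType) (Y : topologicalType) : Prop :=
  exists d : Y -> Y -> R,
    [/\ forall x, d x x = 0,
        forall x y, d x y = 0 -> x = y,
        forall x y, d x y = d y x,
        forall y x z, d x z <= d x y + d y z &
        forall x, nbhs x = nbhs_ball_ (fun x e => [set y | d x y < e]) x].

Definition first_countable (Y : topologicalType) : Prop :=
  forall y : Y, exists B : set (set Y),
    [/\ countable B, B `<=` nbhs y &
        forall A, nbhs y A -> exists2 U, B U & U `<=` A].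

Definition countable_character (Y : topologicalType) (K : set Y) : Prop :=
  exists B : set (set Y),
    [/\ countable B, forall U, B U -> open U /\ K `<=` U &
        forall O, open O -> K `<=` O -> exists2 U, B U & U `<=` O].

Definition countable_type (Y : topologicalType) : Prop :=
  forall K : set Y, compact K ->
    exists L : set Y, [/\ K `<=` L, compact L & countable_character L].

Definition pointwise_countable_type (Y : topologicalType) : Prop :=
  forall y : Y,
    exists L : set Y, [/\ L y, compact L & countable_character L].

(* A set [D] coerces to the type of its elements, which the library equips
   with the induced topology. *)
Definition has_dense_pointwise_countable_type (Y : topologicalType) : Prop :=
  exists2 D : set Y, dense D & pointwise_countable_type D.

Definition countably_compact (Y : topologicalType) (A : set Y) : Prop :=
  forall U : nat -> set Y, (forall n, open (U n)) -> A `<=` \bigcup_n U n ->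
    exists N, A `<=` \bigcup_(n < N) U n.

Definition quasi_perfect (Y Z : topologicalType) (f : Y -> Z) : Prop :=
  [/\ continuous f, forall C, closed C -> closed (f @` C) &
      forall z, countably_compact (f @^-1` [set z])].

Definition M_space (R : realType) (Y : topologicalType) : Prop :=
  exists (M : metricType R) (f : Y -> M),
    quasi_perfect f /\ range f = setT.

(* The cluster point is one of the sequence (y_n), not a limit point of its
   set of values: a constant sequence has a cluster point. *)
Definition q_space (Y : topologicalType) : Prop :=
  forall y : Y, exists2 U : nat -> set Y, forall n, nbhs y (U n) &
    forall y_ : nat -> Y, (forall n, U n (y_ n)) ->
      cluster (y_ n @[n --> \oo]) !=set0.

Definition hemi_C_compact (R : realType) (X : topologicalType) : Prop :=
  exists2 A_ : nat -> set X, forall n, C_compact R (A_ n) &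
    forall A, C_compact R A -> exists n, A `<=` A_ n.

(* Main.v *)
From HB Require Import structures.
Require Import Defs.
From mathcomp Require Import finmap.
From mathcomp Require Import all_boot all_order all_algebra.
From mathcomp Require Import all_classical all_reals all_analysis.
From mathcomp Require Import lra.

Set Implicit Arguments.
Unset Strict Implicit.
Unset Printing Implicit Defensive.

Import Order.TTheory GRing.Theory Num.Theory.
Import numFieldNormedType.Exports.

Local Open Scope classical_set_scope.
Local Open Scope ring_scope.

(** Everything reduces to two facts about Y = C_rc(X).

    If Y has a q-point, then X is hemi-C-compact.  A neighbourhood U_n of f
    contains every function that agrees with f on some C-compact set B_n, and
    the closures of the B_n absorb all C-compact sets.  Otherwise some
    C-compact A has points a_n outside closure(B_n); complete regularity gives
    functions g_n that equal f on B_n and exceed n at a_n.  They lie in U_n, so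
    they cluster at some h; but h is bounded on A, and being bounded on A by a
    given constant is an open condition that the g_n eventually violate.  As
    exceeding n at a_n is an open condition too, the g_n can be taken in any
    prescribed dense subspace, so it is enough to have a q-point relative to a
    dense subspace ([dense_q_point_hemi_C_compact]).

    If X is hemi-C-compact, then Y is metrizable.  The C-compact-open topology
    is that of uniform convergence on C-compact sets ([nbhs_C_rcP]), because
    traces of zero sets on C-compact sets are C-compact
    ([C_compact_zero_set]).  When the A_n absorb all C-compact sets, the
    supremum over n and x in A_n of min(1/(n+1), |f x - g x|) is a compatible
    distance ([nbhs_hemi_dist]).

    The other implications hold in every space.  Metrizability gives all the
    other conditions, since compact sets then have countable character and the
    identity is a quasi-perfect map onto a metric space.  In the other
    direction, each condition gives q-points: a sequence that is eventually in
    every open set containing a given countably compact set must cluster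
    ([cluster_seq_countably_compact]).  *)

(** * Points with the q-property *)

Definition q_point (Y : topologicalType) (y : Y) : Prop :=
  exists2 U : nat -> set Y, forall n, nbhs y (U n) &
    forall y_ : nat -> Y, (forall n, U n (y_ n)) ->
      cluster (y_ n @[n --> \oo]) !=set0.

Lemma compact_countably_compact (Y : topologicalType) (K : set Y) :
  compact K -> countably_compact K.
Proof.
move=> /compact_near_coveringP cK U oU KU.
have : \forall n \near \oo, K `<=` (\bigcup_(i < n) U i).
  apply: cK => x /KU[m _ Ux]; near=> x' n.
  exists m => /=; first by near: n; exact: nbhs_infty_gt.
  by near: x'; exact: (open_nbhs_nbhs (conj (oU m) Ux)).
by move=> [N _ NK]; exists N; apply: NK => /=.
Unshelve. all: by end_near. Qed.

(** Without a cluster point, the complements of the closures of the tails form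
    an increasing open cover of K; finitely many of them cover K, so one open
    set containing K misses a tail. *)
Lemma cluster_seq_countably_compact (Y : topologicalType) (K : set Y)
    (y_ : nat -> Y) : countably_compact K ->
  (forall O, open O -> K `<=` O -> \forall n \near \oo, O (y_ n)) ->
  cluster (y_ n @[n --> \oo]) !=set0.
Proof.
move=> cK yK; apply: contrapT => /set0P/negP/negPn/eqP clu0.
pose F N := closure [set y_ n | n in [set n | (N <= n)%N]].
have oF N : open (~` F N) by apply: closed_openC; exact: closed_closure.
have KF : K `<=` \bigcup_N ~` F N.
  move=> x Kx; have : ~ cluster (y_ n @[n --> \oo]) x by rewrite clu0.
  rewrite clusterE => /existsNP[S /not_implyP[[N _ NS] Sx]].
  exists N => // Fx; apply: Sx; apply: closureS Fx => _ [n nN <-].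
  exact: NS.
have [N KN] := cK _ oF KF.
have /yK/(_ KN)[M _ MN] : open (\bigcup_(n < N) ~` F n).
  by apply: bigcup_open => i _; exact: oF.
have [m mN] := MN (maxn M N) (leq_maxl _ _); apply.
apply: subset_closure; exists (maxn M N) => //=.
by rewrite leq_max (ltnW mN) orbT.
Qed.

(** Common form of first countability (K a point) and of the countable
    character of a compact set K through y. *)
Lemma q_point_of_countable_base (Y : topologicalType) (y : Y) (K : set Y)
    (B : set (set Y)) : compact K -> countable B -> B `<=` nbhs y ->
  (forall O, open O -> K `<=` O -> exists2 U, B U & U `<=` O) -> q_point y.
Proof.
move=> cK /countable_injP[r rI] By BK.
(* Decreasing neighbourhoods of y, eventually inside each member of B. *)
pose V n := [set z | forall U, B U -> (r U < n)%N -> U z].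
have Vy n : nbhs y (V n).
  elim: n => [|n IH]; first by apply: filterS filterT => z _ U _.
  have [[U [BU rU]]|noU] := pselect (exists U, B U /\ r U = n).
    apply: filterS (filterI IH (By _ BU)) => z [Vz Uz] W BW.
    rewrite ltnS leq_eqVlt => /orP[/eqP rW|]; last exact: Vz.
    by rewrite (rI W U) ?inE // rW.
  apply: filterS IH => z Vz W BW.
  rewrite ltnS leq_eqVlt => /orP[/eqP rW|]; last exact: Vz.
  by exfalso; apply: noU; exists W.
exists V => // y_ yV.
apply: (cluster_seq_countably_compact (compact_countably_compact cK)).
move=> O oO KO; have [U BU UO] := BK O oO KO.
by exists (r U).+1 => // n rn; apply: UO; exact: (yV n).
Qed.

Lemma first_countable_q_space (Y : topologicalType) :
  first_countable Y -> q_space Y.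
Proof.
move=> fY y; have [B [cB By BU]] := fY y.
apply: (q_point_of_countable_base (@compact_set1 _ y) cB By) => O oO yO.
by apply: BU; apply: open_nbhs_nbhs; split=> //; exact: yO.
Qed.

Lemma pointwise_countable_type_q_space (Y : topologicalType) :
  pointwise_countable_type Y -> q_space Y.
Proof.
move=> pY y; have [K [Ky cK [B [cB BK BO]]]] := pY y.
apply: (q_point_of_countable_base cK cB _ BO) => U /BK[oU KU].
by apply: open_nbhs_nbhs; split=> //; exact: KU.
Qed.

(** The preimages of the balls around f y shrink to the fibre of f y, because f
    is closed, and that fibre is countably compact. *)
Lemma M_space_q_space (R : realType) (Y : topologicalType) :
  M_space R Y -> q_space Y.
Proof.
move=> [M [f [[cf clf ccf] _]]] y.
exists (fun n => f @^-1` ball (f y) n.+1%:R^-1) => [n|y_ yU].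
  by apply: cf; apply: nbhsx_ballx; rewrite invr_gt0.
apply: (cluster_seq_countably_compact (ccf (f y))) => O oO KO.
have : nbhs (f y) (~` (f @` ~` O)).
  apply: open_nbhs_nbhs; split; first exact/closed_openC/clf/open_closedC.
  by move=> [z Oz /KO].
rewrite -nbhs_ballE => -[e /= e0 eO].
near=> n; apply: contrapT => Oyn.
have : ball (f y) e (f (y_ n)).
  apply: le_ball (yU n); apply: ltW; near: n.
  exact: (near_infty_natSinv_lt (PosNum e0)).
by move=> /eO; apply; exists (y_ n).
Unshelve. all: by end_near. Qed.

(** * Metrizable spaces *)

(** The underlying type, free of the topology of [T], so that a metric structure
    can be built on it without clashing with that topology. *)
Definition bare (T : Type) : Type := T.
HB.instance Definition _ (T : choiceType) := Choice.copy (bare T) T.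

Section metrizable_spaces.
Context {R : realType} {Y : topologicalType}.

Section distance.
Variable d : Y -> Y -> R.
Hypotheses (d0 : forall x, d x x = 0) (d_eq : forall x y, d x y = 0 -> x = y)
  (dC : forall x y, d x y = d y x)
  (d_tri : forall y x z, d x z <= d x y + d y z)
  (d_nbhs : forall x, nbhs x = nbhs_ball_ (fun x e => [set y | d x y < e]) x).

Let dball_nbhs x e : 0 < e -> nbhs x [set y | d x y < e].
Proof. by move=> e0; rewrite d_nbhs; exists e. Qed.

Let dball_open x e : open [set y | d x y < e].
Proof.
rewrite openE => y /= xy; rewrite /interior d_nbhs.
exists (e - d x y); rewrite /= ?subr_gt0 // => z /= yz.
by rewrite (le_lt_trans (d_tri y x z)) // -ltrBrDl.
Qed.

Lemma distance_countable_character (K : set Y) :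
  compact K -> countable_character K.
Proof.
move=> /compact_near_coveringP cK.
pose V n := \bigcup_(x in K) [set y | d x y < n.+1%:R^-1].
exists (range V); split.
- exact: card_image_le.
- move=> _ [n _ <-]; split; first by apply: bigcup_open => x _.
  by move=> x Kx; exists x => //=; rewrite d0 invr_gt0.
- move=> O oO KO.
  have : \forall n \near \oo,
      K `<=` [set x | forall y, d x y < n.+1%:R^-1 -> O y].
    apply: cK => x /KO Ox.
    have : nbhs x O by exact: open_nbhs_nbhs.
    rewrite d_nbhs => -[e /= e0 eO].
    have e20 : 0 < e / 2 by rewrite divr_gt0.
    near=> x' n => y /= x'y; apply: eO => /=.
    rewrite (le_lt_trans (d_tri x' x y)) // [e]splitr; apply: ltrD.
      by near: x'; exact: dball_nbhs.
    apply: lt_trans x'y _; near: n.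
    exact: (near_infty_natSinv_lt (PosNum e20)).
  move=> [N _ /(_ N (leqnn _)) NO]; exists (V N); first by exists N.
  by move=> y [x Kx xy]; exact: NO Kx _ xy.
Unshelve. all: by end_near. Qed.

Lemma distance_subspace (D : set Y) : metrizable R D.
Proof.
exists (fun x y => d (\val x) (\val y)); split=> //.
- by move=> x y /d_eq /val_inj.
- move=> x; apply/predeqP => W; split.
    case=> _ [[G oG <-] Gx GW]; have : nbhs (\val x) G by exact: open_nbhs_nbhs.
    by rewrite d_nbhs => -[e e0 eG]; exists e => // y xy; apply: GW; exact: eG.
  move=> [e e0 eW]; have : nbhs x (\val @^-1` [set y | d (\val x) y < e]).
    exact: (@initial_continuous _ _ _ x _ (dball_nbhs _ _)).
  by apply: filterS => y; exact: eW.
Qed.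

Lemma distance_M_space : M_space R Y.
Proof.
pose M : metricType R :=
  HB.pack (bare Y) (isMetric.Build R (bare Y) d0 d_eq dC d_tri).
pose i : Y -> M := id.
have nbhsM (x : Y) : nbhs x = nbhs (i x).
  by rewrite d_nbhs -nbhs_ballE.
have openM (O : set Y) : open O = open (O : set M).
  rewrite !openE; apply: propext; split=> h x /h; by rewrite /interior nbhsM.
exists M, i; split; last by apply/seteqP; split=> // x _; exists x.
split.
- by move=> x W; rewrite -nbhsM.
- move=> C; rewrite image_id -openC openM openC.
  by [].
- by move=> z; apply: compact_countably_compact; exact: compact_set1.
Qed.
End distance.

Lemma metrizable_countable_character (K : set Y) :
  metrizable R Y -> compact K -> countable_character K.
Proof.
by move=> [d [d0 _ _ d_tri dn]]; exact: distance_countable_character.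
Qed.

Lemma metrizable_subspace (D : set Y) : metrizable R Y -> metrizable R D.
Proof. by move=> [d [d0 ? ? ? ?]]; exact: (@distance_subspace d). Qed.

Lemma metrizable_M_space : metrizable R Y -> M_space R Y.
Proof. by move=> [d [d0 ? ? ? ?]]; exact: (@distance_M_space d). Qed.

Lemma metrizable_first_countable : metrizable R Y -> first_countable Y.
Proof.
move=> mY y.
have [B [cB yB BO]] := metrizable_countable_character mY (@compact_set1 _ y).
exists B; split=> // [U /yB[oU yU]|A /nbhs_interior yA].
  by apply: open_nbhs_nbhs; split=> //; exact: yU.
have [|U BU UA] := BO A^° (@open_interior _ _).
  by move=> _ ->; exact: nbhs_singleton.
by exists U => //; apply: subset_trans UA _; exact: interior_subset.
Qed.

Lemma metrizable_countable_type : metrizable R Y -> countable_type Y.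
Proof.
by move=> mY K cK; exists K; split=> //; exact: metrizable_countable_character.
Qed.
End metrizable_spaces.

Lemma countable_type_pointwise (Y : topologicalType) :
  countable_type Y -> pointwise_countable_type Y.
Proof.
move=> cY y; have [K [yK cK ccK]] := cY _ (@compact_set1 _ y).
by exists K; split=> //; exact: yK.
Qed.

(** * C-compact sets *)

Section C_compact_sets.
Context {R : realType} {X : topologicalType}.
Implicit Types A B : set X.

Lemma C_compact_image A (f : X -> R) :
  C_compact R A -> continuous f -> compact (f @` A).
Proof. by move=> cA cf; exact: (cA (mkcts cf)). Qed.

Lemma C_compact_set1 (x : X) : C_compact R [set x].
Proof. by move=> f; rewrite image_set1; exact: compact_set1. Qed.

Lemma C_compact_bigcup (I : choiceType) (D : set I) (F : I -> set X) :
  finite_set D -> (forall i, D i -> C_compact R (F i)) ->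
  C_compact R (\bigcup_(i in D) F i).
Proof.
move=> finD cF f; rewrite image_bigcup -bigsetU_fset_set //.
rewrite big_seq; elim/big_ind: _ => [||i]; first exact: compact0.
  exact: compactU.
by rewrite in_fset_set // inE => /cF; exact.
Qed.

(** A and its closure have the same image, since f(A) is closed. *)
Lemma closure_C_compact A : C_compact R A -> C_compact R (closure A).
Proof.
move=> cA f; suff -> : f @` closure A = f @` A by [].
apply/seteqP; split=> [_ [x Ax <-]|]; last exact/image_subset/subset_closure.
have /closure_id -> : closed (f @` A).
  by apply: compact_closed => //; exact: norm_hausdorff.
move=> W /(cts_fun x)/Ax[y [Ay Wy]].
by exists (f y); split=> //; exists y.
Qed.

(** If p is in the closure of h(A with z = 0), then |h - p| + |z| has infimum 0
    on A; its image of A is closed, so it vanishes at some point of A, where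
    h = p and z = 0. *)
Lemma C_compact_zero_set A (z : X -> R) : C_compact R A -> continuous z ->
  C_compact R (A `&` z @^-1` [set 0]).
Proof.
move=> cA cz h; apply: subclosed_compact (cA h) _; last first.
  by apply: image_subset; exact: subIsetl.
move=> p hp; pose phi x := `|h x - p| + `|z x|.
have cphi : continuous phi.
  move=> x; apply: cvgD; apply: cvg_norm; last exact: cz.
  by apply: cvgB; [exact: cts_fun|exact: cvg_cst].
have /closure_id clphi : closed (phi @` A).
  by apply: compact_closed; [exact: norm_hausdorff|exact: C_compact_image].
have : closure (phi @` A) 0.
  move=> W; rewrite -nbhs_ballE => -[e /= e0 eW].
  have [_ [[x [Ax /= zx0] <-] px]] := hp _ (nbhsx_ballx p e e0).
  exists (phi x); split; first by exists x.
  apply: eW; rewrite /ball /= sub0r normrN /phi zx0 normr0 addr0.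
  by rewrite normr_id distrC.
rewrite -clphi => -[x Ax /eqP]; rewrite paddr_eq0 // !normr_eq0 subr_eq0.
by move=> /andP[/eqP hx /eqP zx]; exists x.
Qed.

End C_compact_sets.

(** * The C-compact-open topology is uniform convergence on C-compact sets *)

Section C_compact_open_topology.
Context {R : realType} {X : topologicalType}.
Implicit Types (A B : set X) (f g : C_rc R X).

Lemma C_rc_continuous f : continuous (f : X -> R).
Proof. exact: cts_fun. Qed.

Lemma open_C_rc A (V : set R) : A !=set0 -> C_compact R A -> open V ->
  open [set g : C_rc R X | forall x, A x -> V (g x)].
Proof.
move=> A0 cA oV.
have -> : [set g : C_rc R X | forall x, A x -> V (g x)] =
    [set g : C_rc R X | g @` A `<=` V].
  apply/seteqP; split=> [g gA _ [x Ax <-]|g gA x Ax]; first exact: gA.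
  by apply: gA; exists x.
exists [set [set g : C_rc R X | g @` A `<=` V]]; last by rewrite bigcup_set1.
move=> _ ->; exists [fset (A, V)]%fset.
  by move=> i /fset1P ->; rewrite inE.
apply/seteqP; split=> [g gA|g gA i /fset1P ->//].
by apply: (gA (A, V)); exact/fset1P.
Qed.

Lemma C_rc_subbase f W : nbhs f W ->
  exists D' : {fset set X * set R},
    [/\ forall AV, AV \in D' -> [/\ AV.1 !=set0, C_compact R AV.1 & open AV.2],
        forall AV, AV \in D' -> f @` AV.1 `<=` AV.2 &
        forall g, (forall AV, AV \in D' -> g @` AV.1 `<=` AV.2) -> W g].
Proof.
rewrite nbhsE => -[_ [[B sB <-] [C BC Cf] sUW]].
have [D' sD' DC] := sB _ BC.
exists D'; split=> [AV /sD'|AV DAV|g gD]; first by rewrite inE.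
  by move: Cf; rewrite -DC => /(_ AV DAV).
have Cg : C g by rewrite -DC => AV /gD.
by apply: sUW; exists C.
Qed.

(** A set [A, V] containing f allows a uniform error on A because f(A) is
    compact in V.  Conversely, cover f(B) by finitely many balls of radius e / 4
    with centres c: the part of B where |f - c| <= e / 4 is C-compact, being the
    trace of a zero set, and sending each of these parts into the ball of radius
    e / 2 around its c forces |f - g| < e on B. *)
Lemma nbhs_C_rcP f W : nbhs f W <-> exists B e,
  [/\ C_compact R B, 0 < e &
      forall g, (forall x, B x -> `|f x - g x| < e) -> W g].
Proof.
split.
  move=> /C_rc_subbase[D' [D'P fD' D'W]].
  exists (\bigcup_(AV in [set` D']) AV.1).
  have : \forall e \near 0^'+, (\bigcap_(AV in [set` D'])
      [set e : R | forall x r, AV.1 x -> `|f x - r| < e -> AV.2 r]) e.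
    apply: filter_bigI => -[A V] AVD; have [_ cA oV] := D'P _ AVD.
    have : \forall e \near 0^'+,
        f @` A `<=` [set s | forall r, `|s - r| < e -> V r].
      move: (cA f) => /compact_near_coveringP; apply=> s fAs.
      have : nbhs s V by apply: open_nbhs_nbhs; split=> //; exact: (fD' _ AVD).
      rewrite -nbhs_ballE => -[e /= e0 eV].
      have e20 : 0 < e / 2 by rewrite divr_gt0.
      near=> s' e' => r /= s'r; apply: eV; rewrite /ball /=.
      rewrite (le_lt_trans (ler_distD s' s r)) // [e]splitr; apply: ltrD.
        by near: s'; exact: nbhsx_ballx.
      by apply: lt_le_trans s'r _; near: e'; exact: nbhs_right_le.
    by apply: filterS => e eA x r Ax; apply: eA; exists x.
  move=> De; have [e [e0 eD]] := filter_ex (filterI (nbhs_right_gt 0) De).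
  exists e; split=> //.
    by apply: C_compact_bigcup => [|AV /D'P[]].
  move=> g gf; apply: D'W => AV AVD _ [x Ax <-].
  by apply: (eD AV AVD x) => //; apply: gf; exists AV.
move=> [B [e [cB e0 BW]]].
have e40 : 0 < e / 4 by rewrite divr_gt0.
have e20 : 0 < e / 2 by rewrite divr_gt0.
have : exists2 D' : {fset R}, {subset D' <= [set f x | x in B]} &
    f @` B `<=` \bigcup_(c in [set` D']) ball c (e / 4).
  have := cB f; rewrite compact_cover => /(_ R [set f x | x in B]
    (fun c => ball c (e / 4))); apply.
    by move=> c _; exact: ball_open.
  by move=> c Bc; exists c => //; exact: ballxx.
move=> [D' D'B BD'].
pose z c := cst 0 \max (fun x => `|f x - c| - e / 4).
have cz c : continuous (z c).
  apply: max_fun_continuous => x; first exact: cvg_cst.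
  apply: cvgB; last exact: cvg_cst.
  apply: cvg_norm; apply: cvgB; last exact: cvg_cst.
  exact: C_rc_continuous.
have zE c x : (z c x = 0) <-> (`|f x - c| <= e / 4).
  rewrite /z /=; split=> [/max_idPl|h]; first by rewrite subr_le0.
  by apply/max_idPl; rewrite subr_le0.
pose U c := [set g : C_rc R X |
  forall x, (B `&` z c @^-1` [set 0]) x -> ball c (e / 2) (g x)].
have : nbhs f (\bigcap_(c in [set` D']) U c).
  apply: filter_bigI => c /D'B; rewrite inE => -[x Bx fxc].
  apply: open_nbhs_nbhs; split.
    apply: open_C_rc; [|exact: C_compact_zero_set|exact: ball_open].
    by exists x; split=> //=; apply/zE; rewrite fxc subrr normr0 ltW.
  move=> y [By /zE fy]; rewrite /ball /= distrC (le_lt_trans fy) //.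
  by rewrite ltr_pM2l // ltf_pV2 ?posrE // ltr_nat.
apply: filterS => g gU; apply: BW => x Bx.
have [c Dc cx] := BD' (f x) (ex_intro2 _ _ x Bx erefl).
have fxc : `|f x - c| < e / 4 by rewrite distrC.
have := gU c Dc x; rewrite /ball /= => /(_ (conj Bx _)) cg.
rewrite (le_lt_trans (ler_distD c _ _)) // [e]splitr.
apply: ltrD; last by apply: cg; apply/zE; exact: ltW.
by apply: lt_trans fxc _; rewrite ltr_pM2l // ltf_pV2 ?posrE // ltr_nat.
Unshelve. all: by end_near. Qed.

End C_compact_open_topology.

(** * q-points force hemi-C-compactness *)

Section hemi_C_compact_of_q_point.
Context {R : realType} {X : topologicalType}.

(** Only sequences in D are asked to cluster, so that this applies to a q-point
    of the whole space, D being everything, as well as to a q-point of the dense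
    subspace D. *)
Lemma dense_q_point_hemi_C_compact (D : set (C_rc R X)) (f : C_rc R X)
    (U : nat -> set (C_rc R X)) :
  completely_regular_space X -> dense D -> (forall n, nbhs f (U n)) ->
  (forall y_ : nat -> C_rc R X, (forall n, D (y_ n)) ->
     (forall n, U n (y_ n)) -> cluster (y_ n @[n --> \oo]) !=set0) ->
  hemi_C_compact R X.
Proof.
move=> crX dD fU clU.
have /choice[B BP] n : exists B, C_compact R B /\
    forall g : C_rc R X, (forall x, B x -> f x = g x) -> (U n)^° g.
  have /nbhs_C_rcP[B [e [cB e0 BU]]] := nbhs_interior (fU n).
  by exists B; split=> // g fg; apply: BU => x /fg ->; rewrite subrr normr0.
exists (closure \o B) => [n|A cA]; first exact: closure_C_compact (BP n).1.
apply: contrapT => noA.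
have /choice[a aP] n : exists a, A a /\ ~ closure (B n) a.
  have /existsNP[a /not_implyP[Aa Ba]] : ~ A `<=` closure (B n).
    by move=> AB; apply: noA; exists n.
  by exists a.
have /choice[y_ yP] n : exists y, [/\ D y, U n y & n%:R < y (a n)].
  have [Aa Ba] := aP n.
  have /(@uniform_separatorP _ R)[k [ck _ k0 k1]] :=
    crX (a n) _ (@closed_closure _ (B n)) Ba.
  (* k is 0 at a n and 1 on B n, so the function below exceeds n at a n and
     agrees with f on B n. *)
  pose c := n.+1%:R - f (a n).
  have cg : continuous (fun x => f x + c * (1 - k x)).
    move=> x; apply: cvgD; first exact: C_rc_continuous.
    apply: cvgM; first exact: cvg_cst.
    by apply: cvgB; [exact: cvg_cst|exact: ck].
  pose g : C_rc R X := mkcts cg.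
  have gE x : g x = f x + c * (1 - k x) by [].
  have ga : g (a n) = n.+1%:R.
    have ka : k (a n) = 0 by apply: k0; exists (a n).
    by rewrite gE ka subr0 mulr1 addrC subrK.
  have gU : (U n)^° g.
    apply: (BP n).2 => x /subset_closure Bx.
    have kx : k x = 1 by apply: k1; exists x.
    by rewrite gE kx subrr mulr0 addr0.
  have [||y [[Uy ay] Dy]] := dD ((U n)^° `&`
      [set h : C_rc R X | forall x, [set a n] x -> [set` `]n%:R, +oo[] (h x)]).
  - exists g; split=> // _ ->; rewrite /= in_itv /= andbT ga.
    by rewrite ltr_nat.
  - apply: openI; first exact: open_interior.
    apply: open_C_rc; [by exists (a n)|exact: C_compact_set1|].
    exact: interval_open.
  - exists y; split=> //; first exact: interior_subset.
    by have := ay _ erefl; rewrite /= in_itv /= andbT.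
have [h hy] := clU y_ (fun n => let: And3 Dy _ _ := yP n in Dy)
  (fun n => let: And3 _ Uy _ := yP n in Uy).
have [M [_ Mh]] := compact_bounded (cA h).
pose N := `|M| + 1.
have NM : forall x, A x -> `|h x| < N + 1.
  move=> x Ax; apply: (@le_lt_trans _ _ N); last by rewrite ltrDl.
  apply: Mh; last by exists x.
  by rewrite (le_lt_trans (ler_norm M)) // ltrDl.
have [m mN] : exists m : nat, N + 1 < m%:R.
  by exists (Num.truncn (N + 1)).+1; exact: truncnS_gt.
pose W := [set g : C_rc R X | forall x, A x -> ball (0 : R) (N + 1) (g x)].
have hW : nbhs h W.
  apply: open_nbhs_nbhs; split.
    apply: open_C_rc => //; last exact: ball_open.
    by exists (a 0%N); exact: (aP 0%N).1.
  by move=> x Ax; rewrite /ball /= sub0r normrN; exact: NM.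
have ym : nbhs (y_ n @[n --> \oo]) [set y_ n | n in [set n | (m <= n)%N]].
  by exists m => // n mn; exists n.
have [_ [[n /= mn <-] yW]] := hy _ _ ym hW.
have := yW _ (aP n).1; rewrite /ball /= sub0r normrN => yN.
have [_ _ ny] := yP n.
have : n%:R < m%:R :> R.
  apply: lt_trans ny (lt_trans _ mN).
  exact: le_lt_trans (ler_norm _) yN.
by rewrite ltr_nat ltnNge mn.
Qed.

Lemma q_space_hemi_C_compact : completely_regular_space X ->
  q_space (C_rc R X) -> hemi_C_compact R X.
Proof.
move=> crX /(_ (mkcts (@cst_continuous X R 0)))[U fU clU].
have dT : dense [set: C_rc R X] by move=> O [f Of] _; exists f.
by apply: (dense_q_point_hemi_C_compact crX dT fU) => y_ _; exact: clU.
Qed.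

Lemma dense_q_space_hemi_C_compact (D : set (C_rc R X)) :
  completely_regular_space X -> dense D -> q_space D -> hemi_C_compact R X.
Proof.
move=> crX dD qD.
have [|f [_ Df]] := dD setT _ openT.
  by exists (mkcts (@cst_continuous X R 0) : C_rc R X).
pose f' : D := exist _ f (mem_set Df).
have [U fU clU] := qD f'.
have /choice[V VP] n : exists V, nbhs f V /\ val @^-1` V `<=` U n.
  have [_ [[V oV <-] Vf VU]] := fU n.
  by exists V; split=> //; exact: (open_nbhs_nbhs (conj oV Vf)).
apply: (dense_q_point_hemi_C_compact crX dD (fun n => (VP n).1)) => y_ yD yV.
pose z_ n : D := exist _ (y_ n) (mem_set (yD n)).
have [z zy] : cluster (z_ n @[n --> \oo]) !=set0.
  by apply: clU => n; apply: (VP n).2; exact: yV.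
exists (\val z) => S T yS zT.
have [w [Sw Tw]] := zy (val @^-1` S) (val @^-1` T) yS
  (@initial_continuous _ _ _ z _ zT).
by exists (\val w).
Qed.

End hemi_C_compact_of_q_point.

(** * The distance given by an absorbing sequence of C-compact sets *)

Section metric_of_hemi_C_compact.
Context {R : realType} {X : topologicalType} (A_ : nat -> set X).
Implicit Types f g h : C_rc R X.

(* 0 is included because the A_ n may all be empty. *)
Let gaps f g : set R := [set r | r = 0 \/
  exists n x, A_ n x /\ r = Num.min n.+1%:R^-1 `|f x - g x|].

Definition hemi_dist f g : R := sup (gaps f g).

Let gaps0 f g : gaps f g !=set0. Proof. by exists 0; left. Qed.

Lemma hemi_dist_le f g c : 0 <= c ->
  (forall n x, A_ n x -> Num.min n.+1%:R^-1 `|f x - g x| <= c) ->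
  hemi_dist f g <= c.
Proof.
move=> c0 cP; apply: ge_sup => // _ [->//|[n [x [Ax ->]]]]; exact: cP.
Qed.

Let has_sup_gaps f g : has_sup (gaps f g).
Proof.
split=> //; exists 1 => _ [->//|[n [x [_ ->]]]].
by rewrite ge_min invf_le1 // ler1n.
Qed.

Lemma le_hemi_dist f g n x : A_ n x ->
  Num.min n.+1%:R^-1 `|f x - g x| <= hemi_dist f g.
Proof.
by move=> Ax; apply: sup_upper_bound => //; right; exists n, x.
Qed.

Lemma hemi_dist_ge0 f g : 0 <= hemi_dist f g.
Proof. by apply: sup_upper_bound => //; left. Qed.

Lemma hemi_dist_sym f g : hemi_dist f g = hemi_dist g f.
Proof.
by apply/le_anti/andP; split; apply: hemi_dist_le => [|n x Ax];
  rewrite ?hemi_dist_ge0 // distrC; exact: le_hemi_dist.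
Qed.

Lemma hemi_dist_xx f : hemi_dist f f = 0.
Proof.
apply/le_anti; rewrite hemi_dist_ge0 andbT; apply: hemi_dist_le => // n x _.
by rewrite subrr normr0 ge_min lexx orbT.
Qed.

Lemma hemi_dist_triangle g f h :
  hemi_dist f h <= hemi_dist f g + hemi_dist g h.
Proof.
apply: hemi_dist_le => [|n x Ax]; first by rewrite addr_ge0 ?hemi_dist_ge0.
apply: le_trans (lerD (le_hemi_dist f g Ax) (le_hemi_dist g h Ax)).
have c0 : 0 <= n.+1%:R^-1 :> R by rewrite invr_ge0.
move: (ler_distD (g x) (f x) (h x)) (normr_ge0 (f x - g x))
  (normr_ge0 (g x - h x)) c0.
move: `|_| `|_| `|_| _^-1 => fh fg gh c; rewrite /Num.min.
by case: (ltP c fh); case: (ltP c fg); case: (ltP c gh) => *; lra.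
Qed.

Hypothesis A_C_compact : forall n, C_compact R (A_ n).
Hypothesis A_absorbs : forall A, C_compact R A -> exists n, A `<=` A_ n.

Lemma hemi_dist_eq f g : hemi_dist f g = 0 -> f = g.
Proof.
move=> d0; apply/continuousEP => x.
have [n /(_ x erefl) Anx] := A_absorbs (@C_compact_set1 R X x).
have := le_hemi_dist f g Anx; rewrite d0 ge_min leNgt invr_gt0 ltr0n /=.
by rewrite normr_le0 subr_eq0 => /eqP.
Qed.

(** For g to be within e of f it is enough that |f - g| < e / 2 on the finitely
    many A_ n with 1 / (n + 1) >= e / 2, whose union is C-compact.  Conversely,
    at distances below 1 / (n + 1) the truncation does not affect |f - g| on
    A_ n, and every C-compact set lies in some A_ n. *)
Lemma nbhs_hemi_dist f :
  nbhs f = nbhs_ball_ (fun f e => [set g | hemi_dist f g < e]) f.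
Proof.
apply/predeqP => W; split.
  move=> /nbhs_C_rcP[B [e [cB e0 BW]]]; have [n BA] := A_absorbs cB.
  exists (Num.min e n.+1%:R^-1); first by rewrite /= lt_min e0 invr_gt0 /=.
  move=> g /= fg; apply: BW => x /BA/(le_hemi_dist f g)/le_lt_trans/(_ fg).
  rewrite lt_min !gt_min ltxx /= => /andP[/orP[ne gn|//]].
  exact: lt_trans gn ne.
move=> [e /= e0 eW]; apply/nbhs_C_rcP.
have e20 : 0 < e / 2 by rewrite divr_gt0.
have [N _ NP] := near_infty_natSinv_lt (PosNum e20).
exists (\bigcup_(n in `I_N) A_ n), (e / 2); split=> //.
  by apply: C_compact_bigcup.
move=> g fg; apply: eW => /=; apply: (@le_lt_trans _ _ (e / 2)).
  apply: hemi_dist_le => [|n x Ax]; first exact: ltW.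
  rewrite ge_min; have [nN|Nn] := ltnP n N.
    by rewrite (ltW (fg x _)) ?orbT //; exists n.
  by rewrite (ltW (NP n Nn)).
by rewrite ltr_pdivrMr // ltr_pMr // ltr1n.
Qed.

End metric_of_hemi_C_compact.

Lemma hemi_C_compact_metrizable (R : realType) (X : topologicalType) :
  hemi_C_compact R X -> metrizable R (C_rc R X).
Proof.
move=> [A_ cA absA]; exists (hemi_dist A_); split.
- exact: hemi_dist_xx.
- exact: hemi_dist_eq.
- exact: hemi_dist_sym.
- exact: hemi_dist_triangle.
- exact: nbhs_hemi_dist.
Qed.

(** * The equivalence *)

Theorem theorem5p6 (R : realType) (X : topologicalType)
    (hX : tychonoff_space X) :
  [<-> metrizable R (C_rc R X);
       first_countable (C_rc R X);
       countable_type (C_rc R X);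
       pointwise_countable_type (C_rc R X);
       has_dense_pointwise_countable_type (C_rc R X);
       M_space R (C_rc R X);
       q_space (C_rc R X);
       hemi_C_compact R X].
Proof.
have [crX _] := hX.
have metr : q_space (C_rc R X) -> metrizable R (C_rc R X).
  by move=> /(q_space_hemi_C_compact crX)/hemi_C_compact_metrizable.
tfae.
- exact: metrizable_first_countable.
- by move=> /first_countable_q_space/metr; exact: metrizable_countable_type.
- exact: countable_type_pointwise.
- move=> /pointwise_countable_type_q_space/metr mY; exists [set: C_rc R X].
    by move=> G [f Gf] _; exists f.
  apply/countable_type_pointwise/metrizable_countable_type.
  exact: (metrizable_subspace _ mY).
- move=> [D dD /pointwise_countable_type_q_space].
  move=> /(dense_q_space_hemi_C_compact crX dD)/hemi_C_compact_metrizable.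
  exact: metrizable_M_space.
- exact: M_space_q_space.
- exact: q_space_hemi_C_compact.
- exact: hemi_C_compact_metrizable.
Qed.
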